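(* Let $p>1$ be fixed, let $G=(V,E)$ be a connected finite graph, let $\lambda\in\mathbb{R}$ and let $f:V\to\mathbb{R}$ be a function such that $\lambda\int_V f\,d\mu<0$. Then there exists a constant $C$, depending only on $\lambda$, $f$ and $|V|$ (with $p$ fixed; in particular $C$ is independent of $\sigma$ and $u$), such that for every $\sigma\in[0,1]$ and every function $u:V\to\mathbb{R}$ satisfying $$\Delta_p u(x)=\lambda e^{u(x)}\left(e^{u(x)}-\sigma\right)+f(x)\quad\text{for all } x\in V,$$ one has $|u(x)|\leqslant C$ for all $x\in V$.
   Context: A finite graph $G=(V,E)$ has a finite vertex set $V$ and a set $E$ of undirected edges (with unit weights and unit vertex measure); $y\sim x$ means $xy\in E$, and $|V|$ is the number of vertices. For $p>1$ and $u:V\to\mathbb{R}$, the $p$-Laplacian is $$\Delta_p u(x)=\sum_{y\sim x}|u(y)-u(x)|^{p-2}(u(y)-u(x)),$$ where, when $1<p<2$, terms with $u(y)=u(x)$ are taken to be $0$. For $g:V\to\mathbb{R}$, $\int_V g\,d\mu=\sum_{x\in V}g(x)$. *)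

(* Defs.v *)
From HB Require Import structures.
From mathcomp Require Import all_boot all_order all_algebra.
From mathcomp Require Import all_classical all_reals all_analysis.
Set Implicit Arguments.
Unset Strict Implicit.
Unset Printing Implicit Defensive.
Import Order.TTheory GRing.Theory Num.Theory.
Local Open Scope ring_scope.

(* A finite graph is a vertex type V : finType with a symmetric adjacency
   relation e : rel V. Loops are not excluded: since a loop at x contributes
   u x - u x = 0, they do not affect the p-Laplacian. *)

Definition graph_connected (V : finType) (e : rel V) : Prop :=
  forall x y : V, connect e x y.

(* A term with u y = u x vanishes for every p, because of the second factor:
   powR is total, with 0 `^ a = 0 for a != 0 and 0 `^ 0 = 1. *)
Definition pLaplacian (R : realType) (V : finType) (e : rel V) (p : R)
    (u : V -> R) (x : V) : R :=
  \sum_(y : V | e x y) `|u y - u x| `^ (p - 2) * (u y - u x).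

(* Integral against the unit vertex measure. *)
Definition vertex_integral (R : realType) (V : finType) (g : V -> R) : R :=
  \sum_(x : V) g x.

(* Main.v *)
Require Import Defs.
From HB Require Import structures.
From mathcomp Require Import all_boot all_order all_algebra.
From mathcomp Require Import all_classical all_reals all_analysis.
From mathcomp Require Import ring lra.
Set Implicit Arguments.
Unset Strict Implicit.
Unset Printing Implicit Defensive.
Import Order.TTheory GRing.Theory Num.Theory.
Local Open Scope ring_scope.

(* Summing the equation over V kills the p-Laplacian, so the numbers
   t = exp(u x) satisfy sum t (t - sigma) = A := - (sum f) / lambda > 0. Since
   t (t - sigma) + 1 >= t >= 0, this bounds every t from above, and it forces
   t (t - sigma) > A / (|V| + 1) at some vertex, where t is then bounded away
   from 0. The upper bound on t also bounds Delta_p u. Summing Delta_p u over a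
   sublevel set of u leaves only the flux through its boundary, all of whose
   terms are positive; hence the variation of u along each edge is bounded, and
   so, by connectedness, is the oscillation of u. *)

Lemma ler_sum_term (R : numDomainType) (I : finType) (P : pred I) (F : I -> R)
    (i : I) :
  (forall j, P j -> 0 <= F j) -> P i -> F i <= \sum_(j | P j) F j.
Proof.
move=> F0 Pi; rewrite (bigD1 i) //= lerDl.
by apply: sumr_ge0 => j /andP[Pj _]; exact: F0.
Qed.

(** Exchanging the two sums and using the symmetry of [e] turns the sum into its own opposite. *)
Lemma sum_antisymmetric (R : numDomainType) (V : finType) (S : pred V)
    (e : rel V) (phi : V -> V -> R) :
  symmetric e -> (forall x y, phi y x = - phi x y) ->
  \sum_(x | S x) \sum_(y | S y && e x y) phi x y = 0.
Proof.
move=> se aphi; set s := LHS.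
have sN : s = - s.
  rewrite {1}/s (exchange_big_dep S) /=; last by move=> x y _ /andP[].
  rewrite -sumrN; apply: eq_bigr => y Sy.
  rewrite -sumrN; apply: eq_big => [x|x _]; first by rewrite Sy se.
  by rewrite aphi.
by apply/eqP; rewrite -eqNr -sN.
Qed.

(** Edges with both ends in [S] cancel by antisymmetry. Taking [S] to be all of [V] leaves no
    boundary, so the total is 0. *)
Lemma sum_pLaplacian (R : realType) (V : finType) (e : rel V) (p : R)
    (u : V -> R) (S : pred V) :
  symmetric e ->
  \sum_(x | S x) pLaplacian e p u x =
  \sum_(x | S x) \sum_(y | ~~ S y && e x y)
    `|u y - u x| `^ (p - 2) * (u y - u x).
Proof.
move=> se; set phi := fun x y => `|u y - u x| `^ (p - 2) * (u y - u x).
have aphi x y : phi y x = - phi x y.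
  by rewrite /phi distrC -mulrN opprB.
under eq_bigr => x _.
  rewrite /pLaplacian (bigID S) /=.
  under eq_bigl => y do rewrite andbC.
  under [X in _ + X]eq_bigl => y do rewrite andbC.
  over.
by rewrite big_split /= (sum_antisymmetric S se aphi) add0r.
Qed.

Lemma edge_flux_le (R : realType) (V : finType) (e : rel V) (p K : R)
    (u : V -> R) (x y : V) :
  symmetric e -> (forall z, `|pLaplacian e p u z| <= K) ->
  e x y -> u x < u y -> (u y - u x) `^ (p - 1) <= #|V|%:R * K.
Proof.
move=> se HK exy uxy.
have d0 : 0 < u y - u x by rewrite subr_gt0.
have -> : (u y - u x) `^ (p - 1) =
          `|u y - u x| `^ (p - 2) * (u y - u x).
  rewrite gtr0_norm // -[X in _ * X](powRr1 (ltW d0)) -powRD; last first.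
    by rewrite (gt_eqF d0) implybT.
  by congr (_ `^ _); ring.
(* The edge from [x] to [y] leaves this sublevel set, and [u] increases along every edge leaving it;
   so the term of this edge is at most the whole flux. *)
pose S := [pred z | u z <= u x].
have flux_ge0 z w : S z -> ~~ S w ->
    0 <= `|u w - u z| `^ (p - 2) * (u w - u z).
  rewrite /= -ltNge => uz uw; apply: mulr_ge0; first exact: powR_ge0.
  by rewrite subr_ge0 (le_trans uz (ltW uw)).
have Sx : S x by rewrite /=.
have Sy : ~~ S y by rewrite /= -ltNge.
apply: (@le_trans _ _ (\sum_(z | S z) pLaplacian e p u z)).
  rewrite sum_pLaplacian //.
  apply: le_trans (ler_sum_term (i := x) _ Sx); last first.
    by move=> z Sz; apply: sumr_ge0 => w /andP[Sw _]; exact: flux_ge0.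
  apply: (ler_sum_term (P := fun w => ~~ S w && e x w)
    (F := fun w => `|u w - u x| `^ (p - 2) * (u w - u x))).
    by move=> w /andP[Sw _]; exact: flux_ge0.
  by rewrite Sy.
apply: (@le_trans _ _ (\sum_(z : V) K)); last by rewrite sumr_const mulr_natl.
(* Vertices outside [S] contribute 0, and [0 <= K] because [K] bounds an absolute value. *)
rewrite big_mkcond; apply: ler_sum => z _.
case: ifP => _; first exact: le_trans (ler_norm _) (HK z).
exact: le_trans (normr_ge0 _) (HK z).
Qed.

Lemma edge_variation_le (R : realType) (V : finType) (e : rel V) (p K : R)
    (u : V -> R) (x y : V) :
  1 < p -> symmetric e -> (forall z, `|pLaplacian e p u z| <= K) ->
  e x y -> `|u y - u x| <= (#|V|%:R * K) `^ (p - 1)^-1.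
Proof.
move=> hp se HK; wlog uxy : x y / u x <= u y.
  move=> IH exy; have [/IH->//|/ltW uyx] := leP (u x) (u y).
  by rewrite distrC IH // se.
move=> exy; have [->|neq] := eqVneq (u x) (u y).
  by rewrite subrr normr0 powR_ge0.
have {}uxy : u x < u y by rewrite lt_neqAle neq.
have p0 : p - 1 != 0 by rewrite subr_eq0 gt_eqF.
have d0 : 0 <= u y - u x by rewrite subr_ge0 ltW.
rewrite ger0_norm //.
rewrite -[leLHS](powRr1 d0) -[X in _ `^ X <= _](mulfV p0) powRrM.
apply: ge0_ler_powR; rewrite ?nnegrE ?powR_ge0 //.
- by rewrite invr_ge0 subr_ge0 ltW.
- exact: le_trans (powR_ge0 _ _) (edge_flux_le se HK exy uxy).
- exact: edge_flux_le.
Qed.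

Lemma path_variation_le (R : numDomainType) (V : eqType) (e : rel V) (D : R)
    (u : V -> R) (x : V) (s : seq V) :
  (forall y z, e y z -> `|u z - u y| <= D) -> path e x s ->
  `|u (last x s) - u x| <= (size s)%:R * D.
Proof.
move=> HD; elim: s x => [|y s IH] x /=; first by rewrite subrr normr0 mul0r.
case/andP=> /HD hxy /IH hs.
rewrite -natr1 mulrDl mul1r.
by apply: le_trans (ler_distD (u y) _ _) _; exact: lerD.
Qed.

Lemma oscillation_le (R : numDomainType) (V : finType) (e : rel V) (D : R)
    (u : V -> R) (x y : V) :
  graph_connected e -> 0 <= D -> (forall y z, e y z -> `|u z - u y| <= D) ->
  `|u y - u x| <= #|V|%:R * D.
Proof.
move=> ce D0 HD; have /connectP[s0 es0 ->] := ce x y.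
(* A path without repeated vertices has fewer than [#|V|] edges. *)
case: (shortenP es0) => s es us _.
apply: le_trans (path_variation_le HD es) _.
apply: ler_wpM2r => //; rewrite ler_nat.
have := max_card (mem (x :: s)); rewrite (card_uniqP us) /=.
exact: ltnW.
Qed.

Theorem theorem1p1 (R : realType) (p : R) (hp : 1 < p)
    (V : finType) (lambda : R) (f : V -> R)
    (hlf : lambda * vertex_integral f < 0) :
  exists C : R,
    forall e : rel V, symmetric e -> graph_connected e ->
    forall sigma : R, 0 <= sigma <= 1 ->
    forall u : V -> R,
      (forall x : V,
         pLaplacian e p u x = lambda * expR (u x) * (expR (u x) - sigma) + f x) ->
      forall x : V, `|u x| <= C.
Proof.
have l0 : lambda != 0 by apply: contraTneq hlf => ->; rewrite mul0r ltxx.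
pose n : R := #|V|%:R.
have n0 : 0 <= n by rewrite ler0n.
pose A := - vertex_integral f / lambda.
have A0 : 0 < A.
  have -> : A = - (lambda * vertex_integral f) / lambda ^+ 2.
    by rewrite /A; field.
  by rewrite divr_gt0 ?oppr_gt0 // exprn_even_gt0.
(* Below, [T] bounds every [t x = expR (u x)], [a] is exceeded by some [t x * (t x - sigma)], [K]
   bounds the p-Laplacian and [D] the variation of [u] along an edge. None of them involves [e],
   [sigma] or [u]. *)
pose T := A + n.
pose a := A / (n + 1).
have a0 : 0 < a by rewrite divr_gt0 // ltr_wpDl.
pose K := `|lambda| * (T * (T + 1)) + \sum_x `|f x|.
pose D := (n * K) `^ (p - 1)^-1.
exists (T + T / a + n * D) => e se ce sigma /andP[s0 s1] u Hu.
pose t x := expR (u x).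
have t0 x : 0 < t x := expR_gt0 (u x).
have sumA : \sum_x t x * (t x - sigma) = A.
  have : \sum_x pLaplacian e p u x = 0.
    by rewrite (sum_pLaplacian _ _ predT se) big1 // => x _; rewrite big_pred0.
  rewrite (eq_bigr (fun x => lambda * (t x * (t x - sigma)) + f x)); last first.
    by move=> x _; rewrite Hu mulrA.
  rewrite big_split /= -mulr_sumr => /eqP; rewrite addr_eq0 => /eqP sumf.
  by rewrite /A /vertex_integral -sumf mulrC mulKf.
have tT x : t x <= T.
  have <- : \sum_x (t x * (t x - sigma) + 1) = T.
    by rewrite big_split /= sumA sumr_const.
  apply: (@le_trans _ _ (t x * (t x - sigma) + 1)).
    (* As [sigma <= 1], the difference of the two sides is at least [(t x - 1) ^+ 2]. *)
    have := sqr_ge0 (t x - 1); have := t0 x; nra.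
  apply: (ler_sum_term (P := predT) (F := fun x => t x * (t x - sigma) + 1)) => //.
  by move=> y _; have := sqr_ge0 (t y - 1); have := t0 y; nra.
have uT x : u x <= T.
  by apply: le_trans (tT x); have := expR_ge1Dx (u x); rewrite /t; lra.
have T0 : 0 < T by rewrite ltr_wpDr.
have HK x : `|pLaplacian e p u x| <= K.
  rewrite Hu; apply: le_trans (ler_normD _ _) _; apply: lerD; last first.
    by apply: (ler_sum_term (P := predT) (F := fun x => `|f x|)).
  rewrite -mulrA normrM ler_wpM2l // -/(t x).
  rewrite normrM (gtr0_norm (t0 x)).
  apply: ler_pM => //; [exact: ltW | rewrite ler_norml].
  by have := tT x; have := t0 x; lra.
have osc x y : `|u y - u x| <= n * D.
  apply: oscillation_le => //; first exact: powR_ge0.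
  by move=> y' z eyz; exact: edge_variation_le.
(* Otherwise [A <= n * a], whereas [A = n * a + a] with [a > 0]. *)
have [x0 hx0] : exists x0, a < t x0 * (t x0 - sigma).
  apply/existsP; apply: contraT; rewrite negb_exists => /forallP H.
  have : A <= n * a.
    rewrite -sumA mulr_natl -sumr_const; apply: ler_sum => x _.
    by rewrite leNgt H.
  have : (n + 1) * a = A.
    by rewrite /a mulrC divfK // gt_eqF // ltr_wpDl.
  by lra.
(* No logarithm is taken: [- u x0 <= expR (- u x0) = (t x0)^-1], and
   [a < t x0 * (t x0 - sigma) <= t x0 * T]. *)
have ux0 : - (T / a) <= u x0.
  have ge_Nu : - u x0 <= (t x0)^-1.
    by rewrite /t -expRN; have := expR_ge1Dx (- u x0); lra.
  have : (t x0)^-1 <= T / a.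
    rewrite ler_pdivlMr // mulrC ler_pdivrMr //.
    by have := tT x0; have := t0 x0; nra.
  by lra.
have Ta0 : 0 < T / a by exact: divr_gt0.
(* The upper bound is [T]; the lower one, [- (T / a) - n * D], is carried over from [x0] by the
   oscillation. *)
move=> x; have := osc x0 x; rewrite !ler_norml => /andP[h1 h2].
have := uT x; have nD0 : 0 <= n * D by rewrite mulr_ge0 ?powR_ge0.
by lra.
Qed.
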